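(* Let $H$ be a Hilbert $\mathfrak{A}$-module over a $C^*$-algebra $\mathfrak{A}$, let $M,N\in\mathcal{L}(H)$ be two weights, and let $A\in\mathcal{L}(H)$ be such that $A^\dag_{MN}$ exists. Then $A^\dag_{MN}$ belongs to the $C^*$-subalgebra of $\mathcal{L}(H)$ generated by $A$, $M$ and $N$.
   Context: $\mathcal{L}(H)$ is the $C^*$-algebra of adjointable operators on $H$. A weight on $H$ is an operator $M\in\mathcal{L}(H)$ with $M=M^*$ that is invertible in $\mathcal{L}(H)$ (it need not be positive). For weights $M,N\in\mathcal{L}(H)$ and $A\in\mathcal{L}(H)$, the weighted Moore-Penrose inverse $A^\dag_{MN}$ (if it exists) is the (necessarily unique) element $X\in\mathcal{L}(H)$ satisfying $AXA=A$, $XAX=X$, $(MAX)^*=MAX$, $(NXA)^*=NXA$. The $C^*$-subalgebra generated by a set is the smallest norm-closed $*$-subalgebra containing it (not required a priori to contain the unit). *)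

(* Defs.v *)
From HB Require Import structures.
From mathcomp Require Import all_boot all_order all_algebra.
From mathcomp Require Import all_classical all_reals all_analysis.
From mathcomp Require Import complex.

Set Implicit Arguments.
Unset Strict Implicit.
Unset Printing Implicit Defensive.

Import Order.TTheory GRing.Theory Num.Theory.
Import numFieldNormedType.Exports.

Local Open Scope classical_set_scope.
Local Open Scope ring_scope.

(* A C*-algebra is not assumed to be unital, so its product is a field of the
   mixin rather than the product of a MathComp (unital) ring. *)
HB.mixin Record isCStarAlgebra (R : realType) A
    of CompleteNormedModule R[i] A := {
  cmul : A -> A -> A;
  cstar : A -> A;
  cmulA : associative cmul;
  cmulDl : left_distributive cmul +%R;
  cmulDr : right_distributive cmul +%R;
  cmulZl : forall (l : R[i]) a b, cmul (l *: a) b = l *: cmul a b;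
  cmulZr : forall (l : R[i]) a b, cmul a (l *: b) = l *: cmul a b;
  cstarK : involutive cstar;
  cstarD : {morph cstar : a b / a + b};
  cstarZ : forall (l : R[i]) a, cstar (l *: a) = l^* *: cstar a;
  cstarM : forall a b, cstar (cmul a b) = cmul (cstar b) (cstar a);
  cnormM : forall a b, `|cmul a b| <= `|a| * `|b|;
  cnorm_star : forall a, `|cmul (cstar a) a| = `|a| ^+ 2
}.

#[short(type="cstarAlgType")]
HB.structure Definition CStarAlgebra (R : realType) :=
  {A of isCStarAlgebra R A & CompleteNormedModule R[i] A}.

(* Equivalently, a is self-adjoint with spectrum in [0, +oo[. *)
Definition cpos (R : realType) (A : cstarAlgType R) (a : A) : Prop :=
  exists b : A, a = cmul (cstar b) b.

(* Right Hilbert modules, with the inner product linear in its second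
   argument.  By hdot_norm the norm of H is |x| = |<x, x>|^(1/2), and H is
   complete for it. *)
HB.mixin Record isHilbertModule (R : realType) (A : cstarAlgType R) H
    of CompleteNormedModule R[i] H := {
  hact : H -> A -> H;
  hdot : H -> H -> A;
  hactDl : forall (x y : H) (a : A), hact (x + y) a = hact x a + hact y a;
  hactDr : forall (x : H) (a b : A), hact x (a + b) = hact x a + hact x b;
  hactM : forall (x : H) (a b : A), hact x (cmul a b) = hact (hact x a) b;
  hactZl : forall (l : R[i]) (x : H) (a : A), hact (l *: x) a = l *: hact x a;
  hactZr : forall (l : R[i]) (x : H) (a : A), hact x (l *: a) = l *: hact x a;
  hdotDr : forall x y z : H, hdot x (y + z) = hdot x y + hdot x z;
  hdotZr : forall (l : R[i]) (x y : H), hdot x (l *: y) = l *: hdot x y;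
  hdot_act : forall (x y : H) (a : A), hdot x (hact y a) = cmul (hdot x y) a;
  hdot_star : forall x y : H, cstar (hdot x y) = hdot y x;
  hdot_pos : forall x : H, cpos (hdot x x);
  hdot_eq0 : forall x : H, hdot x x = 0 -> x = 0;
  hdot_norm : forall x : H, `|x| ^+ 2 = `|hdot x x|
}.

#[short(type="hilbertModType")]
HB.structure Definition HilbertModule (R : realType) (A : cstarAlgType R) :=
  {H of isHilbertModule R A H & CompleteNormedModule R[i] H}.

Section AdjointableOperators.
Context (R : realType) (A : cstarAlgType R) (H : hilbertModType A).
Implicit Types (x y z : H) (l : R[i]).

Lemma hdot0r x : hdot x 0 = 0.
Proof. by rewrite -(scale0r 0) hdotZr scale0r. Qed.

Lemma hdotNr x y : hdot x (- y) = - hdot x y.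
Proof. by rewrite -scaleN1r hdotZr scaleN1r. Qed.

Lemma hdotBr x y z : hdot x (y - z) = hdot x y - hdot x z.
Proof. by rewrite hdotDr hdotNr. Qed.

Lemma hdotDl x y z : hdot (x + y) z = hdot x z + hdot y z.
Proof. by rewrite -hdot_star hdotDr cstarD !hdot_star. Qed.

Lemma hdotZl l x y : hdot (l *: x) y = l^* *: hdot x y.
Proof. by rewrite -hdot_star hdotZr cstarZ hdot_star. Qed.

Lemma hdotNl x y : hdot (- x) y = - hdot x y.
Proof. by rewrite -[- x]scaleN1r hdotZl rmorphN1 scaleN1r. Qed.

Lemma hdot0l x : hdot 0 x = 0.
Proof. by rewrite -(subrr 0) hdotDl hdotNl subrr. Qed.

Lemma hdot_injl x y : (forall z, hdot x z = hdot y z) -> x = y.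
Proof.
move=> xy; apply/eqP; rewrite -subr_eq0; apply/eqP/(@hdot_eq0 _ A).
by rewrite hdotDl hdotNl xy subrr.
Qed.

Lemma hdot_injr x y : (forall z, hdot z x = hdot z y) -> x = y.
Proof.
by move=> xy; apply: hdot_injl => z; rewrite -hdot_star xy hdot_star.
Qed.

Definition adjoint_of (S T : H -> H) : Prop :=
  forall x y, hdot (T x) y = hdot x (S y).

Definition adjointable : {pred (H -> H)} :=
  fun T => `[< exists S, adjoint_of S T >].

Lemma adjoint_of_sym (S T : H -> H) : adjoint_of S T -> adjoint_of T S.
Proof. by move=> ST x y; rewrite -hdot_star -ST hdot_star. Qed.

Lemma adjoint_of_linear (S T : H -> H) l x y :
  adjoint_of S T -> T (l *: x + y) = l *: T x + T y.
Proof.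
move=> ST; apply: hdot_injl => z.
by rewrite ST !(hdotDl, hdotZl) !ST.
Qed.

Lemma adjointable_submod_closed : submod_closed adjointable.
Proof.
split=> [|l T T' /asboolP[S ST] /asboolP[S' ST']]; apply/asboolP.
  exists (fun=> 0) => x y.
  by rewrite hdot0l hdot0r.
exists (fun x => l^* *: S x + S' x) => x y.
by rewrite hdotDl hdotZl ST ST' hdotDr hdotZr.
Qed.

HB.instance Definition _ :=
  GRing.isSubmodClosed.Build R[i] (H -> H) adjointable
    adjointable_submod_closed.

(* L(H), with composition as product. *)
Record adjop := AdjOp {
  adjop_fun :> H -> H;
  adjop_subproof : adjop_fun \in adjointable
}.

HB.instance Definition _ := [isSub for adjop_fun].
HB.instance Definition _ := [Choice of adjop by <:].
HB.instance Definition _ := [SubChoice_isSubLmodule of adjop by <:].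

Implicit Types (S T U : adjop).

Lemma adjopP S T : S =1 T -> S = T.
Proof. by move=> ST; apply: val_inj; apply: funext. Qed.

Lemma adjopDE S T x : (S + T) x = S x + T x. Proof. by []. Qed.

Lemma adjop_linear T l x y : T (l *: x + y) = l *: T x + T y.
Proof.
by have /asboolP[S ST] := adjop_subproof T; apply: adjoint_of_linear ST.
Qed.

Lemma adjopD T x y : T (x + y) = T x + T y.
Proof. by rewrite -[x]scale1r adjop_linear !scale1r. Qed.

Lemma adjop_has_adjoint T : exists S : adjop, adjoint_of S T.
Proof.
have /asboolP[S ST] := adjop_subproof T.
have adjS : S \in adjointable by apply/asboolP; exists T; apply: adjoint_of_sym.
by exists (AdjOp adjS).
Qed.

Definition adjoint T : adjop := sval (cid (adjop_has_adjoint T)).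

Lemma adjointP T x y : hdot (T x) y = hdot x (adjoint T y).
Proof. exact: (svalP (cid (adjop_has_adjoint T))). Qed.

Lemma adjoint_unique S T : adjoint_of S T -> S = adjoint T.
Proof.
by move=> ST; apply: adjopP => y; apply: hdot_injr => x; rewrite -adjointP ST.
Qed.

Lemma adjop_id_subproof : id \in adjointable.
Proof. by apply/asboolP; exists id. Qed.

Definition adjop_id := AdjOp adjop_id_subproof.

Lemma adjop_comp_subproof S T : S \o T \in adjointable.
Proof.
by apply/asboolP; exists (adjoint T \o adjoint S) => x y /=; rewrite !adjointP.
Qed.

Definition adjop_comp S T := AdjOp (adjop_comp_subproof S T).

Lemma adjop_compA : associative adjop_comp.
Proof. by move=> S T U; apply: adjopP. Qed.

Lemma adjop_comp1l : left_id adjop_id adjop_comp.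
Proof. by move=> T; apply: adjopP. Qed.

Lemma adjop_comp1r : right_id adjop_id adjop_comp.
Proof. by move=> T; apply: adjopP. Qed.

Lemma adjop_compDl : left_distributive adjop_comp +%R.
Proof. by move=> S T U; apply: adjopP. Qed.

Lemma adjop_compDr : right_distributive adjop_comp +%R.
Proof. by move=> S T U; apply: adjopP => x /=; rewrite adjopD. Qed.

HB.instance Definition _ := GRing.Zmodule_isPzRing.Build adjop
  adjop_compA adjop_comp1l adjop_comp1r adjop_compDl adjop_compDr.

Lemma adjopME S T x : (S * T) x = S (T x). Proof. by []. Qed.

Lemma adjopZE l T x : (l *: T) x = l *: T x. Proof. by []. Qed.

Lemma adjointK : involutive adjoint.
Proof.
by move=> T; apply/esym/adjoint_unique/adjoint_of_sym => x y; rewrite adjointP.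
Qed.

Lemma adjointM S T : adjoint (S * T) = adjoint T * adjoint S.
Proof.
by apply/esym/adjoint_unique => x y; rewrite !adjopME !adjointP.
Qed.

(* Extended-real valued, so that the definition does not presuppose that
   adjointable operators are bounded. *)
Definition opnorm T : \bar R :=
  ereal_sup [set (complex.Re `|T x|)%:E | x in [set x : H | `|x| <= 1]].

Definition norm_closed (B : set adjop) : Prop :=
  forall T,
    (forall e : R, 0 < e -> exists2 S, B S & (opnorm (T - S)%R < e%:E)%E) ->
    B T.

(* Closed under the operations of L(H), but not required to contain 1. *)
Definition star_subalgebra (B : set adjop) : Prop :=
  [/\ B 0,
      (forall S T, B S -> B T -> B (S + T)),
      (forall l T, B T -> B (l *: T)),
      (forall S T, B S -> B T -> B (S * T)) &
      (forall T, B T -> B (adjoint T))].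

Definition cstar_generated (G : set adjop) : set adjop :=
  smallest [set B | star_subalgebra B /\ norm_closed B] G.

Definition selfadjoint T : Prop := adjoint T = T.

Definition weight (M : adjop) : Prop :=
  selfadjoint M /\ exists M' : adjop, M * M' = 1 /\ M' * M = 1.

Definition wMPinverse (M N T X : adjop) : Prop :=
  [/\ T * X * T = T, X * T * X = X,
      selfadjoint (M * T * X) & selfadjoint (N * X * T)].

Lemma wMPinverse_unique M N T X Y : weight M -> weight N ->
  wMPinverse M N T X -> wMPinverse M N T Y -> X = Y.
Proof.
move=> [sM [M' [_ M'M]]] [sN [N' [_ N'N]]].
move=> [TXT XTX sMX sNX] [TYT YTY sMY sNY].
have adjW W P : selfadjoint W -> selfadjoint (W * P) -> adjoint P * W = W * P.
  by move=> sW sWP; rewrite -[RHS]sWP adjointM sW.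
have WI (W W' P Q : adjop) : W' * W = 1 -> W * P = W * Q -> P = Q.
  by move=> W'W /(congr1 ( *%R W')); rewrite !mulrA W'W !mul1r.
have aX := adjW M (T * X) sM; have aY := adjW M (T * Y) sM.
have bX := adjW N (X * T) sN; have bY := adjW N (Y * T) sN.
rewrite !mulrA in aX aY bX bY.
have TXY : T * X = T * Y.
  apply: (WI M M') => //; rewrite !mulrA -aX // -{1}TYT -mulrA adjointM -mulrA.
  by rewrite aY // !mulrA aX // -!mulrA (mulrA T X) (mulrA (T * X)) TXT.
have XTY : X * T = Y * T.
  apply: (WI N N') => //; rewrite !mulrA -bX // -{1}TYT !mulrA -mulrA adjointM.
  by rewrite -mulrA bX // !mulrA bY // -!mulrA (mulrA T X) TXT.
by rewrite -XTX XTY -mulrA TXY mulrA YTY.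
Qed.

End AdjointableOperators.

(* Main.v *)
Require Import Defs.
From mathcomp Require Import all_boot all_order all_algebra.
From mathcomp Require Import all_classical all_reals all_analysis.
From mathcomp Require Import complex ring lra.

(* Polarization bounds |<x, y>| by 4 |x| |y|; this crude constant suffices, and
   no order theory in the C*-algebra is needed.  If S is selfadjoint and
   S F S = S for some F, then |(S - i b) y| >= c |y| for y in the range of S,
   uniformly in the real b: for large b since the imaginary part of <y, (S - i b) y>
   is -b <y, y>, for small b since <y, y> = <S y, F y>.  For large b the
   equation (S - i b) S V = S T is solvable in V up to any error within the
   polynomials in S, and the uniform bound propagates this down to b = 0, which
   gives polynomials T in S such that S^2 T is as close to S as desired.  For
   S = N, this puts 1 and N^-1 in every closed *-subalgebra containing N.  If D
   has a group inverse Y and N D is selfadjoint, the same applies to S = N D^3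
   and puts Y in the subalgebra.  Finally, the weighted Moore-Penrose inverse
   is (A# A)^# A#, where A# = N^-1 A^* M and ( )^# is the group inverse. *)

Set Implicit Arguments.
Unset Strict Implicit.
Unset Printing Implicit Defensive.

Import Order.TTheory GRing.Theory Num.Theory.
Import numFieldNormedType.Exports.

Local Open Scope classical_set_scope.
Local Open Scope ring_scope.
Local Open Scope complex_scope.

(** * Real-valued norms on complex normed modules *)

Section RealNorm.
Context (R : realType) (V : normedModType R[i]).
Implicit Types (x y : V).

(** The norm of a module over [R[i]] takes values in [R[i]]; its real part loses nothing and opens
    the estimates to [lra]. *)
Definition rnorm x : R := complex.Re `|x|.

Lemma rnormE x : `|x| = (rnorm x)%:C.
Proof. by rewrite /rnorm RRe_real // normr_real. Qed.

Lemma rnorm_ge0 x : 0 <= rnorm x.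
Proof. by rewrite -lecR -rnormE normr_ge0. Qed.

Lemma rnorm_le0 x : rnorm x <= 0 -> x = 0.
Proof. by rewrite -lecR -rnormE normr_le0 => /eqP. Qed.

Lemma rnorm_triangle x y : rnorm (x + y) <= rnorm x + rnorm y.
Proof. by rewrite -lecR rmorphD /= -!rnormE ler_normD. Qed.

Lemma rnormN x : rnorm (- x) = rnorm x.
Proof. by rewrite /rnorm normrN. Qed.

Lemma rnormB x y : rnorm (x - y) <= rnorm x + rnorm y.
Proof. by rewrite -(rnormN y) rnorm_triangle. Qed.

Lemma rnormZ (l : R[i]) x : rnorm (l *: x) = complex.Re `|l| * rnorm x.
Proof.
by rewrite /rnorm normrZ rnormE -[`|l|]RRe_real ?normr_real // -rmorphM.
Qed.

Lemma rnormZr (t : R) x : rnorm (t%:C *: x) = `|t| * rnorm x.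
Proof. by rewrite rnormZ normc_def /= expr0n /= addr0 sqrtr_sqr. Qed.

Lemma rnormZi (t : R) x : rnorm ((0 +i* t)%C *: x) = `|t| * rnorm x.
Proof. by rewrite rnormZ normc_def /= expr0n /= add0r sqrtr_sqr. Qed.

End RealNorm.

(** * Geometric decay and Cauchy sequences with a rate *)

Lemma exists_exprn_lt (R : realType) (q e : R) : 0 <= q < 1 -> 0 < e ->
  exists n, q ^+ n < e.
Proof.
move=> /andP[q0 q1] e0.
have cq : (q ^+ n : R) @[n --> \oo] --> (0 : R).
  by apply: cvg_expr; rewrite ger0_norm.
have /cvgrPdist_lt/(_ e e0)[n _ /(_ n)] := cq.
move=> /(_ (leqnn n)); rewrite sub0r normrN ger0_norm ?exprn_ge0 //.
by exists n.
Qed.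

Lemma cauchy_bounded_limit (R : realType) (V : completeNormedModType R[i])
    (u : nat -> V) (e : nat -> R) :
  (forall d, 0 < d -> exists n, e n < d) ->
  (forall n m, (n <= m)%N -> rnorm (u m - u n) <= e n) ->
  exists x, forall n, rnorm (x - u n) <= e n.
Proof.
move=> e0 ue.
have /cauchy_cvg cu : cauchy (u n @[n --> \oo]).
  apply/cauchy_exP => d d0.
  have dE : d = (complex.Re d)%:C by rewrite RRe_real // gtr0_real.
  have [n en] := e0 (complex.Re d) ltac:(by rewrite -ltcR -dE).
  exists (u n); exists n => // m /= nm.
  rewrite -ball_normE /= distrC rnormE dE ltcR.
  exact: le_lt_trans (ue _ _ nm) en.
exists (lim (u n @[n --> \oo])) => n; apply/ler_addgt0Pr => d d0.
have /cvgrPdist_lt/(_ d%:C) := cu; rewrite ltcR => /(_ d0)[m _ um].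
have := um (maxn m n) (leq_maxl _ _); rewrite /= rnormE ltcR => um1.
have := ue n (maxn m n) (leq_maxr _ _) => um2.
set L := lim _ in um1 *.
rewrite (_ : L - u n = (L - u (maxn m n)) + (u (maxn m n) - u n)).
  have := rnorm_triangle (L - u (maxn m n)) (u (maxn m n) - u n); lra.
by rewrite addrA subrK.
Qed.

(** * A crude Cauchy-Schwarz inequality in Hilbert modules *)

Section HilbertModuleNorm.
Context (R : realType) (A : cstarAlgType R) (H : hilbertModType A).
Implicit Types (x y z : H) (S T : adjop H).

(** The C*-identity and submultiplicativity give |b|^2 <= |b^*| |b|; cancel |b|, then apply the
    result to the adjoint. *)
Lemma rnorm_cstar (a : A) : rnorm (cstar a) = rnorm a.
Proof.
suff le (b : A) : rnorm b <= rnorm (cstar b).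
  by apply/le_anti; rewrite le -{2}(cstarK a) le.
have [->|b0] := eqVneq b 0.
  by rewrite (_ : rnorm 0 = 0) ?rnorm_ge0 // /rnorm normr0.
have b_gt0 : 0 < rnorm b by rewrite -ltcR -rnormE normr_gt0.
have := cnormM (cstar b) b.
rewrite cnorm_star !rnormE -rmorphXn -rmorphM /= lecR expr2.
by rewrite ler_pM2r.
Qed.

Lemma rnorm_hdotxx x : rnorm (hdot x x : A) = rnorm x ^+ 2.
Proof.
by apply: complexI; rewrite rmorphXn /= -!rnormE -(@hdot_norm _ A).
Qed.

Lemma hdot_polarization x y :
  4%:R *: (hdot x y : A) = (hdot (x + y) (x + y) - hdot (x - y) (x - y))
    + (0 -i* 1)%C *: (hdot (x + 'i%C *: y) (x + 'i%C *: y)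
                     - hdot (x - 'i%C *: y) (x - 'i%C *: y)).
Proof.
have pol (u v : H) : (hdot (u + v) (u + v) - hdot (u - v) (u - v) : A)
   = 2%:R *: (hdot u v + hdot v u).
  have -> : hdot (u + v) (u + v)
      = (hdot u u + hdot v v) + (hdot u v + hdot v u) :> A.
    by rewrite hdotDl !hdotDr (addrC (hdot v u)) addrACA.
  have -> : hdot (u - v) (u - v)
      = (hdot u u + hdot v v) - (hdot u v + hdot v u) :> A.
    by rewrite hdotDl hdotNl !hdotDr !hdotNr opprB addrACA -opprD.
  by rewrite opprB addrC addrA subrK scaler_nat mulr2n.
rewrite !pol hdotZl hdotZr; move: (hdot x y) (hdot y x) => c d.
have -> : Num.conj ('i%C : R[i]) = - 'i%C.
  by apply/eqP; rewrite eq_complex /= ?oppr0 !eqxx.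
have e1 : (0 -i* 1)%C * 2%:R * 'i%C = 2%:R :> R[i].
  by apply/eqP; rewrite eq_complex /=; apply/andP; split; apply/eqP; ring.
rewrite !scalerDr !scalerA !mulrN e1 scaleNr addrACA subrr addr0 -scalerDl.
by rewrite -natrD.
Qed.

Lemma rnorm_hdot x y : rnorm (hdot x y : A) <= 4%:R * rnorm x * rnorm y.
Proof.
have sq_le (u v w : H) : rnorm w <= rnorm v ->
    rnorm (hdot (u + w) (u + w) : A) <= (rnorm u + rnorm v) ^+ 2.
  move=> wv; rewrite rnorm_hdotxx ler_pXn2r ?nnegrE ?addr_ge0 ?rnorm_ge0 //.
  exact: le_trans (rnorm_triangle _ _) (lerD _ _).
have le_sq (u v : H) : rnorm (hdot u v : A) <= (rnorm u + rnorm v) ^+ 2.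
  have le_v w : w \in [:: v; - v; 'i%C *: v; - ('i%C *: v)] ->
      rnorm w <= rnorm v.
    rewrite !inE => /or4P[] /eqP-> //;
      by rewrite ?rnormN // -['i%C]/(0 +i* 1)%C rnormZi normr1 mul1r.
  have := congr1 (fun a : A => rnorm a) (hdot_polarization u v).
  rewrite -(rmorph_nat (@real_complex R)) rnormZr ger0_norm // => eq4.
  have := sq_le u v _ (le_v v _); rewrite inE eqxx => /(_ isT) le1.
  have := sq_le u v _ (le_v (- v) _); rewrite !inE eqxx orbT => /(_ isT) le2.
  have := sq_le u v _ (le_v ('i%C *: v) _).
  rewrite !inE eqxx !orbT => /(_ isT) le3.
  have := sq_le u v _ (le_v (- ('i%C *: v)) _).
  rewrite !inE eqxx !orbT => /(_ isT) le4.
  move: eq4; rewrite -[(0 -i* 1)%C]/(0 +i* (-1))%C => eq4.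
  have := rnorm_triangle (hdot (u + v) (u + v) - hdot (u - v) (u - v) : A)
    ((0 +i* (-1))%C *: (hdot (u + 'i%C *: v) (u + 'i%C *: v)
                     - hdot (u - 'i%C *: v) (u - 'i%C *: v))).
  rewrite -eq4 rnormZi normrN1 mul1r => t0.
  have t1 := rnormB (hdot (u + v) (u + v) : A) (hdot (u - v) (u - v)).
  have t2 := rnormB (hdot (u + 'i%C *: v) (u + 'i%C *: v) : A)
    (hdot (u - 'i%C *: v) (u - 'i%C *: v)).
  lra.
have [->|x0] := eqVneq x 0.
  by rewrite hdot0l /rnorm !normr0 /= mulr0 mul0r.
have [->|y0] := eqVneq y 0.
  by rewrite hdot0r /rnorm !normr0 /= mulr0.
have gt0 (z : H) : z != 0 -> 0 < rnorm z.
  by rewrite -normr_gt0 rnormE ltcR.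
(* At unit vectors the bound [(rnorm u + rnorm v) ^+ 2] equals 4, the constant of the statement. *)
have := le_sq ((rnorm x)^-1%:C *: x) ((rnorm y)^-1%:C *: y).
rewrite hdotZl hdotZr !rnormZ norm_conjC -!rnormZ !rnormZr.
rewrite !ger0_norm ?invr_ge0 ?rnorm_ge0 // !mulVf ?gt_eqF ?gt0 //.
rewrite mulrA -invfM mulrC ler_pdivrMr ?mulr_gt0 ?gt0 //.
by move/le_trans; apply; rewrite le_eqVlt; apply/orP; left; apply/eqP; ring.
Qed.

End HilbertModuleNorm.

(** * Adjointable operators are bounded *)

Section Boundedness.
Context (R : realType) (A : cstarAlgType R) (H : hilbertModType A).
Implicit Types (x y z : H) (S T : adjop H).

Lemma adjop0 T : T 0 = 0.
Proof. by apply: (addrI (T 0)); rewrite -adjopD !addr0. Qed.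

Lemma adjopZ T l x : T (l *: x) = l *: T x.
Proof. by rewrite -[l *: x]addr0 adjop_linear adjop0 addr0. Qed.

Lemma adjopN T x : T (- x) = - T x.
Proof. by rewrite -scaleN1r adjopZ scaleN1r. Qed.

Definition opbound T (k : R) := forall x, rnorm (T x) <= k * rnorm x.

(* Uniform boundedness by Sokal's gliding hump: if T is unbounded, then a
   vector x built by successive perturbations makes <T z_n, x> = <z_n, T^* x>
   too large for vectors z_n on which T grows fast. *)
Lemma adjop_bounded T : exists2 k, 0 < k & opbound T k.
Proof.
apply: contrapT => unb.
have /choice[z Tz] (n : nat) : exists z, 20%:R ^+ n * rnorm z < rnorm (T z).
  apply: contrapT => nz; apply: unb; exists (20%:R ^+ n) => [|x].
    by rewrite exprn_gt0.
  by rewrite leNgt; apply/negP => ltx; apply: nz; exists x.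
have Tz_gt0 n : 0 < rnorm (T (z n)).
  by apply: le_lt_trans (Tz n); rewrite mulr_ge0 ?exprn_ge0 ?rnorm_ge0.
have z_gt0 n : 0 < rnorm (z n).
  rewrite lt_neqAle rnorm_ge0 andbT; apply/eqP => z0.
  have /rnorm_le0 zn0 : rnorm (z n) <= 0 by rewrite -z0.
  by have := Tz_gt0 n; rewrite zn0 adjop0 /rnorm normr0 ltxx.
(* The growth rate 20^n of [T] on [z n] beats the step size 10^-n, so that [q n * rnorm (w n)]
   exceeds 2^n |z_n|. *)
pose q n : R := 10%:R^-1 ^+ n.
have q_gt0 n : 0 < q n by rewrite exprn_gt0 ?invr_gt0.
have qS n : q n.+1 = 10%:R^-1 * q n by rewrite /q exprS.
pose w n := T (z n).
pose v n : H := (q n / rnorm (w n))%:C *: w n.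
have rv n : rnorm (v n) = q n.
  by rewrite rnormZr ger0_norm ?divfK ?gt_eqF ?divr_ge0 ?ltW ?Tz_gt0.
have wv n : rnorm (hdot (w n) (v n) : A) = q n * rnorm (w n).
  rewrite hdotZr rnormZr rnorm_hdotxx expr2 mulrA.
  by rewrite ger0_norm ?divfK ?gt_eqF ?divr_ge0 ?ltW ?Tz_gt0.
pose big n x := q n * rnorm (w n) <= rnorm (hdot (w n) x : A).
(* The two inner products differ by 2 <w_n, v_n>, of norm [2 * q n * rnorm (w n)], so they cannot
   both be small. *)
have bigP n x : big n (x + v n) \/ big n (x - v n).
  rewrite /big; set a := hdot _ (x + v n); set b := hdot _ (x - v n).
  have ab : a - b = 2%:R *: hdot (w n) (v n).
    by rewrite /a /b !hdotDr hdotNr opprB addrC addrA subrK scaler_nat mulr2n.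
  have := rnormB a b; rewrite ab -(rmorph_nat (@real_complex R)) rnormZr wv.
  rewrite ger0_norm //.
  by case: (leP _ (rnorm a)) => ? ?; [left|right; lra].
pose fix u n := if n is m.+1 then
  (if `[< big m (u m + v m) >] then u m + v m else u m - v m) else 0.
have u_big n : big n (u n.+1).
  by rewrite /=; case: asboolP => // ; case: (bigP n (u n)).
have u_step n : rnorm (u n.+1 - u n) <= q n.
  by rewrite /=; case: ifP => _; rewrite addrAC subrr add0r ?rnormN rv.
(* The factor 10/9 is the sum of the geometric series of ratio 1/10. *)
have [x xu] : exists x, forall n, rnorm (x - u n) <= 10%:R / 9%:R * q n.
  apply: cauchy_bounded_limit => [d d0|n m].
    have [|n qn] := @exists_exprn_lt R (10%:R^-1) (d / 2%:R) _ ltac:(lra).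
      by apply/andP; split; lra.
    by exists n; move: qn; rewrite -/(q n); have := q_gt0 n; lra.
  move=> nm; suff : rnorm (u m - u n) <= 10%:R / 9%:R * (q n - q m).
    by have := q_gt0 m; lra.
  rewrite -(subnK nm); elim: (m - n)%N => [|k IH].
    by rewrite add0n !subrr mulr0 /rnorm normr0.
  have := rnorm_triangle (u (k + n).+1 - u (k + n)%N) (u (k + n)%N - u n).
  rewrite addrA subrK addSn qS; have := u_step (k + n)%N; lra.
(* The steps after [n] cost at most 4/9 of [q n * rnorm (w n)], so |<w_n, x>| is at least 5/9 of it.
   The constant 8 suffices because 8 * 5/9 > 4, where 4 is the constant of [rnorm_hdot]. *)
have [n le_n] : exists n, 8%:R * rnorm (adjoint T x) < 2%:R ^+ n.
  have r0 := rnorm_ge0 (adjoint T x).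
  have [|n] := @exists_exprn_lt R 2%:R^-1
    (8%:R * rnorm (adjoint T x) + 1)^-1 _ ltac:(rewrite invr_gt0; lra).
    by apply/andP; split; lra.
  rewrite exprVn ltf_pV2 ?posrE ?exprn_gt0 //; last lra.
  by exists n; lra.
have wx : rnorm (hdot (w n) x : A) <= 4%:R * rnorm (z n) * rnorm (adjoint T x).
  by rewrite adjointP rnorm_hdot.
have wu : rnorm (hdot (w n) (x - u n.+1) : A)
    <= 4%:R / 9%:R * (q n * rnorm (w n)).
  apply: le_trans (rnorm_hdot _ _) _.
  have := ler_wpM2l (ltW (Tz_gt0 n)) (xu n.+1); rewrite -/(w n) qS.
  lra.
have := rnormB (hdot (w n) x : A) (hdot (w n) (x - u n.+1)).
rewrite -hdotBr subKr; have := u_big n; rewrite /big.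
have qw : 2%:R ^+ n * rnorm (z n) < q n * rnorm (w n).
  rewrite (_ : 2%:R = 10%:R^-1 * 20%:R); last by field.
  by rewrite exprMn -mulrA ltr_pM2l //; apply: Tz.
have zn : 8%:R * rnorm (adjoint T x) * rnorm (z n) < 2%:R ^+ n * rnorm (z n).
  by rewrite ltr_pM2r.
have := mulr_ge0 (rnorm_ge0 (adjoint T x)) (rnorm_ge0 (z n)).
lra.
Qed.
End Boundedness.

(** * Approximate inversion of a regular selfadjoint operator *)

Section RegularSelfadjoint.
Context (R : realType) (A : cstarAlgType R) (H : hilbertModType A).
Context (S F : adjop H) (S_sa : selfadjoint S) (SFS : S * F * S = S).
Implicit Types (x y : H) (T U : adjop H) (b c e k : R).

Definition ishift b : adjop H := S - (0 +i* b)%C *: (1 : adjop H).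

Lemma ishiftE b x : ishift b x = S x - (0 +i* b)%C *: x.
Proof. by []. Qed.

(** As [S] is selfadjoint, <x, S x> cancels in <(S - i b) x, x> - <x, (S - i b) x>, which leaves 2 i
    b <x, x>. *)
Lemma ishift_lower_bound b x : `|b| * rnorm x <= 4%:R * rnorm (ishift b x).
Proof.
have [->|x0] := eqVneq x 0.
  by rewrite adjop0 /rnorm !normr0 !mulr0.
have rx : 0 < rnorm x by rewrite -ltcR -rnormE normr_gt0.
have eq2 : (0 +i* (2%:R * b))%C *: (hdot x x : A)
    = cstar (hdot x (ishift b x)) - hdot x (ishift b x).
  rewrite hdot_star ishiftE hdotBr hdotDl hdotNl hdotZr hdotZl.
  rewrite adjointP S_sa opprB addrC addrA subrK.
  rewrite -scalerBl; congr (_ *: _).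
  by apply/eqP; rewrite eq_complex /=; apply/andP; split; apply/eqP; ring.
have := congr1 (fun a : A => rnorm a) eq2.
rewrite rnormZi rnorm_hdotxx normrM ger0_norm // => eq3.
have := rnormB (cstar (hdot x (ishift b x) : A)) (hdot x (ishift b x)).
rewrite -eq3 rnorm_cstar => le1.
have le2 := @rnorm_hdot _ A H x (ishift b x).
rewrite -(ler_pM2l rx); lra.
Qed.

Lemma ishift_range_lower_bound :
  exists2 c, 0 < c & forall b y, c * rnorm (S y) <= rnorm (ishift b (S y)).
Proof.
have [f f0 Ff] := adjop_bounded F.
have Slb y : rnorm (S y) <= 4%:R * f * rnorm (S (S y)).
  set x := S y.
  have [->|x0] := eqVneq x 0.
    by rewrite adjop0 /rnorm normr0 mulr0.
  have rx : 0 < rnorm x by rewrite -ltcR -rnormE normr_gt0.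
  rewrite -(ler_pM2l rx) -expr2 -(@rnorm_hdotxx _ A).
  have SFx : S (F x) = x by rewrite -[RHS]/(S y) -[in RHS]SFS.
  have -> : hdot x x = hdot (S x) (F x) :> A by rewrite adjointP S_sa SFx.
  apply: le_trans (rnorm_hdot _ _) _.
  have := ler_wpM2l (rnorm_ge0 (S x)) (Ff x); lra.
pose c := (32%:R * f)^-1; have c0 : 0 < c by rewrite invr_gt0 mulr_gt0.
exists c => // b y; set x := S y.
have cf : c * f = 32%:R^-1 by rewrite /c; field; rewrite gt_eqF.
(* Above the threshold [4 * c], [ishift_lower_bound] gives [c] at once. Below it, |S x| >= 8 c |x|
   by [Slb], and the shift removes at most 4 c |x|. *)
have [b_big|b_small] := leP (4%:R * c) `|b|.
  have := ishift_lower_bound b x.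
  have := ler_wpM2r (rnorm_ge0 x) b_big; lra.
have := rnormB (S x - (0 +i* b)%C *: x) (- ((0 +i* b)%C *: x)).
rewrite opprK subrK rnormN rnormZi -ishiftE.
have := ler_wpM2l (ltW c0) (Slb y); rewrite -/x.
have := ler_wpM2r (rnorm_ge0 x) (ltW b_small).
rewrite (_ : c * (4%:R * f * rnorm (S x)) = 8%:R^-1 * rnorm (S x)).
  by have := mulr_ge0 (ltW c0) (rnorm_ge0 x); lra.
by transitivity (4%:R * (c * f) * rnorm (S x)); [ring | rewrite cf; field].
Qed.

Lemma ishift_comm b : S * ishift b = ishift b * S.
Proof.
by apply: adjopP => x; rewrite !adjopME !ishiftE adjopD adjopN adjopZ.
Qed.

(** The residual is [S] times an element of [C], up to sign, because [S] commutes with [ishift b];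
    so it can serve as the next right-hand side, and the corrections add up. *)
Lemma opbound_approx_iter (C : set (adjop H)) b T k :
  (forall l T U, C T -> C U -> C (l *: T + U)) ->
  (forall T, C T -> C (S * T)) ->
  (forall U k, C U -> 0 < k -> opbound (S * U) k ->
     exists2 V, C V & opbound (ishift b * S * V - S * U) (3%:R / 4%:R * k)) ->
  C T -> 0 < k -> opbound (S * T) k -> forall n,
  exists2 V, C V & opbound (ishift b * S * V - S * T) ((3%:R / 4%:R) ^+ n * k).
Proof.
move=> CD CS half CT k0 Tk; elim=> [|n [V CV Vn]].
  exists 0; first by rewrite -(subrr T) addrC -scaleN1r; apply: CD.
  by move=> x; rewrite mulr0 sub0r -[X in rnorm X]/(- (S * T) x) rnormN mul1r.
have shiftS : S * (T - ishift b * V) = - (ishift b * S * V - S * T).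
  rewrite opprB mulrBr; congr (_ - _); rewrite !mulrA; congr (_ * _).
  exact: ishift_comm.
have Cshift U : C U -> C (ishift b * U).
  move=> CU; rewrite (_ : _ * _ = - (0 +i* b)%C *: U + S * U); first by auto.
  by apply: adjopP => x; rewrite adjopME ishiftE scaleNr addrC.
have CB U V' : C U -> C V' -> C (U - V').
  by move=> CU CV'; rewrite addrC -scaleN1r; apply: CD.
have kn : 0 < (3%:R / 4%:R) ^+ n * k by rewrite mulr_gt0 // exprn_gt0 //; lra.
have [|W CW Wn] := half (T - ishift b * V) _ (CB _ _ CT (Cshift _ CV)) kn.
  move=> x; rewrite shiftS -[X in rnorm X]/(- (ishift b * S * V - S * T) x).
  by rewrite rnormN Vn.
exists (V + W); first by rewrite addrC -[W]scale1r; apply: CD.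
move=> x; rewrite exprS -(mulrA (3%:R / 4%:R)).
rewrite (_ : _ - S * T = ishift b * S * W - S * (T - ishift b * V)).
  exact: Wn.
by rewrite shiftS opprK mulrDr addrCA addrA.
Qed.

(** [C] is kept abstract since three choices occur below: the [T] with [N * T] in the subalgebra
    (when 1 is not yet known to lie there), the subalgebra itself, and its elements commuting with
    [S]. *)
Lemma regular_selfadjoint_approx (C : set (adjop H)) e : 0 < e ->
  C 1 -> (forall l T U, C T -> C U -> C (l *: T + U)) ->
  (forall T, C T -> C (S * T)) ->
  exists2 T, C T & opbound (S * S * T - S) e.
Proof.
move=> e0 C1 CD CS.
have [c c0 c_lb] := ishift_range_lower_bound.
pose solvable b := forall T e, C T -> 0 < e ->
  exists2 V, C V & opbound (ishift b * S * V - S * T) e.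
have solvableW b : (forall U k, C U -> 0 < k -> opbound (S * U) k ->
    exists2 V, C V & opbound (ishift b * S * V - S * U) (3%:R / 4%:R * k)) ->
    solvable b.
  move=> half T d CT d0; have [k k0 Tk] := adjop_bounded (S * T).
  have [||n qn] := @exists_exprn_lt R (3%:R / 4%:R) (d / k).
  - by apply/andP; split; lra.
  - by rewrite divr_gt0.
  have [V CV Vn] := opbound_approx_iter CD CS half CT k0 Tk n.
  exists V => // x; apply: le_trans (Vn x) _; apply: (ler_wpM2r (rnorm_ge0 _)).
  by rewrite -ler_pdivlMr // ltW.
(* Solving at [b] up to k/4 gives c |S V x| <= (5/4) k |x|. Passing to [b'] thus adds at most (5/16)
   k |x|, for a total of 9/16 < 3/4. *)
have solvable_step b b' : `|b - b'| <= c / 4%:R -> solvable b -> solvable b'.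
  move=> bb' solb; apply: solvableW => U k CU k0 Uk.
  have k4 : 0 < k / 4%:R by lra.
  have [V CV Vk] := solb U _ CU k4.
  exists V => // x.
  rewrite (_ : (ishift b' * S * V - S * U) x =
    (ishift b * S * V - S * U) x + (0 +i* (b - b'))%C *: (S (V x))); last first.
    have -> : (0 +i* (b - b'))%C = (0 +i* b)%C - (0 +i* b')%C :> R[i].
      by apply/eqP; rewrite eq_complex /= subrr !eqxx.
    rewrite scalerBl -[RHS]/((ishift b (S (V x)) - S (U x)) + _).
    rewrite -[LHS]/(ishift b' (S (V x)) - S (U x)) !ishiftE.
    by rewrite [RHS]addrAC addrA subrK.
  have le1 := rnorm_triangle ((ishift b * S * V - S * U) x)
    ((0 +i* (b - b'))%C *: (S (V x))); rewrite rnormZi in le1.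
  have le2 := rnormB ((ishift b * S * V - S * U) x) (- (S * U) x).
  rewrite opprK subrK rnormN in le2.
  have le3 : c * rnorm (S (V x)) <= rnorm ((ishift b * S * V) x).
    exact: c_lb.
  have le4 := ler_wpM2r (rnorm_ge0 (S (V x))) bb'.
  have := Uk x; have := Vk x; have := mulr_ge0 (ltW k0) (rnorm_ge0 x).
  lra.
have solvable_large : exists2 b0, 0 < b0 & forall b, b0 <= b -> solvable b.
  have [s s0 Ss] := adjop_bounded S.
  exists (2%:R * s) => [|b sb]; first lra.
  have b0 : 0 < b by lra.
  (* For large [b] the term -i b dominates, so (i / b) U is a first approximation: its residual (i /
     b) S S U is at most k/2 once b >= 2 s. *)
  apply: solvableW => U k CU k0 Uk; exists ((0 +i* b^-1)%C *: U).
    (* [CD] only yields combinations l T + U, hence the form (l - 1) U + U. *)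
    by rewrite -[_ *: U]addr0 -(subrr U) addrCA -scaleN1r addrC -scalerDl; auto.
  move=> x; rewrite (_ : _ x = (0 +i* b^-1)%C *: S (S (U x))).
    rewrite rnormZi ger0_norm ?invr_ge0 ?(ltW b0) // ler_pdivrMl //.
    have := Ss (S (U x)); have := ler_wpM2l (ltW s0) (Uk x); rewrite adjopME.
    have kx0 := mulr_ge0 (ltW k0) (rnorm_ge0 x).
    have := ler_wpM2r kx0 sb; have := mulr_ge0 (ltW s0) kx0.
    lra.
  rewrite -[LHS]/(ishift b (S ((0 +i* b^-1)%C *: U x)) - S (U x)) ishiftE.
  rewrite !adjopZ scalerA.
  have -> : (0 +i* b)%C * (0 +i* b^-1)%C = - 1 :> R[i].
    apply/eqP; rewrite eq_complex /=.
    apply/andP; split; apply/eqP; last by ring.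
    by rewrite mul0r sub0r mulfV ?gt_eqF.
  by rewrite scaleN1r opprK addrK.
have {solvable_large}[b0 b00 large] := solvable_large.
have [n nb0] : exists n, b0 <= n%:R * (c / 4%:R).
  exists (Num.Def.trunc (b0 / (c / 4%:R))).+1.
  by rewrite -ler_pdivrMr ?divr_gt0 // ltW // truncnS_gt.
(* Descent from [n%:R * (c / 4%:R)], which is at least [b0], down to 0 in steps of c/4. *)
have sol n' : (n' <= n)%N -> solvable ((n - n')%:R * (c / 4%:R)).
  elim: n' => [_|m IH mn]; first by rewrite subn0; apply: large.
  apply: solvable_step (IH (ltnW mn)).
  rewrite -mulrBl -(subnSK mn) -natr1 addrAC subrr add0r mul1r.
  by rewrite ger0_norm // divr_ge0 // ltW.
have [V CV Ve] := sol n (leqnn n) 1 e C1 e0.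
exists V => //; move: Ve; rewrite subnn mul0r mulr1 (_ : ishift 0 = S) //.
by rewrite /ishift (_ : (0 +i* 0)%C = 0) // scale0r subr0.
Qed.
End RegularSelfadjoint.

(** * Membership of inverses in closed *-subalgebras *)

Section GeneratedSubalgebra.
Context (R : realType) (AA : cstarAlgType R) (H : hilbertModType AA).
Implicit Types (S T U V M N A X : adjop H) (B : set (adjop H)).

Lemma adjop_scalerAr l T U : T * (l *: U) = l *: (T * U).
Proof. by apply: adjopP => x; rewrite adjopZE !adjopME adjopZE adjopZ. Qed.

Lemma adjop_scalerAl l T U : (l *: T) * U = l *: (T * U).
Proof. exact: adjopP. Qed.

(** Multiplication by the fixed [U] and [V] is continuous. Only the products need to lie in [B], so
    [U] and [V] may be inverses not yet known to belong to it. *)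
Lemma norm_closed_mul_approx B U V T : norm_closed B ->
  (forall e : R, 0 < e -> exists2 S, B (U * S * V) & opbound (S - T) e) ->
  B (U * T * V).
Proof.
move=> closedB approx; apply: closedB => e e0.
have [u u0 Uu] := adjop_bounded U; have [v v0 Vv] := adjop_bounded V.
(* The half restores the strict inequality, since a supremum only inherits a weak one. *)
have d0 : 0 < e / 2%:R / u / v by rewrite !divr_gt0.
have [S BS ST] := approx _ d0; exists (U * S * V) => //.
have lt_e : ((e / 2%:R)%:E < e%:E)%E by rewrite lte_fin; lra.
apply: le_lt_trans lt_e; apply: ge_ereal_sup => _ [x x1 <-]; rewrite lee_fin.
have rx1 : rnorm x <= 1 by rewrite -lecR -rnormE.
rewrite [X in adjop_fun X x](_ : _ = - (U * (S - T) * V)); last first.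
  by rewrite mulrBr mulrBl opprB.
rewrite -[X in `|X|]/(- U ((S - T) (V x))) normrN.
apply: le_trans (Uu _) _.
have := ler_wpM2l (ltW u0) (ST (V x)).
have := ler_wpM2l (ltW (mulr_gt0 u0 d0)) (Vv x).
have -> : u * (e / 2%:R / u / v) * (v * rnorm x) = e / 2%:R * rnorm x.
  by field; rewrite !gt_eqF.
have := ler_wpM2l (ltW e0) rx1.
lra.
Qed.

(** Let N N T tend to N. Multiplying by N^-1 shows that N T tends to 1; once 1 is in [B],
    multiplying by N^-2 shows that T tends to N^-1. *)
Lemma weight_inv_mem B N Ni : selfadjoint N -> N * Ni = 1 -> Ni * N = 1 ->
  star_subalgebra B -> norm_closed B -> B N -> B 1 /\ B Ni.
Proof.
move=> N_sa NNi NiN [B0 BD BZ BM _] closedB BN.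
have NNiN : N * Ni * N = N by rewrite NNi mul1r.
have B1 : B 1.
  rewrite -NiN -[Ni * N]mulr1; apply: norm_closed_mul_approx => // e e0.
  have [|l T U CT CU|T CT|T CT Te] :=
    @regular_selfadjoint_approx _ _ _ N Ni N_sa NNiN (fun T => B (N * T)) e e0.
  - by rewrite mulr1.
  - by rewrite mulrDr adjop_scalerAr; auto.
  - by auto.
  by exists (N * N * T); rewrite // mulr1 !mulrA NiN mul1r.
split=> //; rewrite -[Ni]mulr1 -NiN mulrA -[_ * N]mulr1.
apply: norm_closed_mul_approx => // e e0.
have [l T U BT BU|T BT|T BT Te] :=
  @regular_selfadjoint_approx _ _ _ N Ni N_sa NNiN B e e0 B1; try by auto.
exists (N * N * T) => //.
by rewrite mulr1 !mulrA -(mulrA Ni Ni) NiN mulr1 NiN mul1r.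
Qed.

Lemma selfadjoint_mulr M P : selfadjoint M -> selfadjoint (M * P) ->
  adjoint P * M = M * P.
Proof. by move=> M_sa MP_sa; rewrite -[RHS]MP_sa adjointM M_sa. Qed.

(** With S = N D^3, Y = Y^2 N^-1 S Y^2 is a limit of the Y^2 N^-1 S S T Y^2. The cube outlasts Y^2
    on both sides: Y^2 N^-1 S = D and S Y^2 = N D, so these products equal D T N D when T commutes
    with S. *)
Lemma group_inverse_mem B N Ni D Y :
  selfadjoint N -> N * Ni = 1 -> Ni * N = 1 -> selfadjoint (N * D) ->
  D * Y * D = D -> Y * D * Y = Y -> D * Y = Y * D ->
  star_subalgebra B -> norm_closed B -> B 1 -> B N -> B D -> B Y.
Proof.
move=> N_sa NNi NiN ND_sa DYD YDY DY [B0 BD BZ BM _] closedB B1 BN BDD.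
have DYY : D * Y * Y = Y by rewrite DY YDY.
have D3YY : D * D * D * Y * Y = D.
  by rewrite -(mulrA _ Y) -(mulrA (D * D)) (mulrA D Y) DYY -mulrA DY mulrA.
have YYD3 : Y * Y * (D * D * D) = D.
  by rewrite !mulrA -(mulrA Y Y) -DY (mulrA Y) -DY DYY -DY DYD.
have [S SE] : exists S, S = N * D * D * D by exists (N * D * D * D).
have S_sa : selfadjoint S.
  have DN := selfadjoint_mulr N_sa ND_sa.
  by rewrite /selfadjoint SE !adjointM N_sa DN (mulrA _ N D) DN !mulrA DN.
have NiS : Ni * S = D * D * D by rewrite SE !mulrA NiN mul1r.
have SYY : S * Y * Y = N * D by rewrite -[in RHS]D3YY SE !mulrA.
have S_regular : S * (Y * Y * Y * Ni) * S = S.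
  by rewrite !mulrA SYY -(mulrA _ Ni) NiS -(mulrA N) !mulrA -(mulrA N)
    -(mulrA N) DYD.
have YE : Y = Y * Y * Ni * S * (Y * Y).
  by rewrite -(mulrA _ Ni) NiS YYD3 mulrA DYY.
rewrite YE; apply: norm_closed_mul_approx => // e e0.
have [|l T U [BT cT] [BU cU]|T [BT cT]|T [BT cT] Te] :=
  @regular_selfadjoint_approx _ _ _ S _ S_sa S_regular
    (fun T => B T /\ S * T = T * S) e e0.
- by rewrite mulr1 mul1r.
- split; first by auto.
  by rewrite mulrDr mulrDl adjop_scalerAr adjop_scalerAl cT cU.
- by split; [rewrite SE; auto 6 | rewrite -[in RHS]mulrA -cT].
exists (S * S * T) => //.
have -> : Y * Y * Ni * (S * S * T) * (Y * Y) = D * T * (N * D).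
  rewrite -SYY -(mulrA S S) cT !mulrA -(mulrA _ Ni) NiS.
  by rewrite YYD3.
by auto.
Qed.

(** The two selfadjointness conditions become [As * Xs = X * A] and [Xs * As = A * X]. Hence
    [X * Xs] is the group inverse of [As * A], both products being [X * A], and
    [X = X * Xs * As]. *)
Lemma wMPinverse_mem B M N Mi Ni A X :
  selfadjoint M -> M * Mi = 1 -> Mi * M = 1 ->
  selfadjoint N -> N * Ni = 1 -> Ni * N = 1 -> wMPinverse M N A X ->
  star_subalgebra B -> norm_closed B -> B A -> B M -> B N -> B X.
Proof.
move=> M_sa MMi MiM N_sa NNi NiN [AXA XAX MAX_sa NXA_sa].
move=> subB closedB BA BM BN.
have [B1 BNi] := weight_inv_mem N_sa NNi NiN subB closedB BN.
have [B0 BD BZ Bm Badj] := subB.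
(* The adjoints of A and X for the indefinite inner products <M x, y> and
   <N x, y>. *)
pose As := Ni * adjoint A * M; pose Xs := Mi * adjoint X * N.
have NAs : N * As = adjoint A * M by rewrite /As !mulrA NNi mul1r.
have MXs : M * Xs = adjoint X * N by rewrite /Xs !mulrA MMi mul1r.
have AsXs : As * Xs = X * A.
  rewrite /As -mulrA MXs -!mulrA (mulrA (adjoint A)) -adjointM.
  by rewrite selfadjoint_mulr ?mulrA // NiN mul1r.
have XsAs : Xs * As = A * X.
  rewrite /Xs -mulrA NAs -!mulrA (mulrA (adjoint X)) -adjointM.
  by rewrite selfadjoint_mulr ?mulrA // MiM mul1r.
have AsXsAs : As * Xs * As = As.
  have MAX : adjoint (A * X) * M = M * (A * X).
    by rewrite selfadjoint_mulr ?mulrA.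
  by rewrite -mulrA XsAs /As -mulrA -MAX mulrA -(mulrA Ni) -adjointM AXA.
have XXsAs : X * Xs * As = X by rewrite -mulrA XsAs mulrA XAX.
have BAs : B As by rewrite /As; auto.
suff BY : B (X * Xs) by rewrite -XXsAs; auto.
have YD : X * Xs * (As * A) = X * A by rewrite mulrA XXsAs.
have DY : As * A * (X * Xs) = X * A.
  by rewrite -mulrA (mulrA A) -XsAs -AsXs -[in RHS]AsXsAs !mulrA.
apply: (@group_inverse_mem B N Ni (As * A)) => //; last by auto.
(* Here N (As A) = A^* M A, which is visibly selfadjoint. *)
- by rewrite /selfadjoint mulrA NAs !adjointM M_sa adjointK mulrA.
- by rewrite DY -AsXs mulrA AsXsAs.
- by rewrite YD mulrA XAX.
- by rewrite DY YD.
Qed.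
End GeneratedSubalgebra.

Theorem theorem4p3 (R : realType) (AA : cstarAlgType R) (H : hilbertModType AA)
    (M N A X : adjop H)
    (M_weight : weight M) (N_weight : weight N)
    (X_wMP : wMPinverse M N A X) :
  cstar_generated [set A; M; N] X.
Proof.
move: M_weight N_weight => [M_sa [Mi [MMi MiM]]] [N_sa [Ni [NNi NiN]]].
move=> B [[subB closedB] gB].
by apply: (wMPinverse_mem M_sa MMi MiM N_sa NNi NiN X_wMP subB closedB);
  apply: gB; [left; left | left; right | right].
Qed.
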